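(* Let $X\subset\mathbb{R}^n$ be nonempty and open, let $f_j\colon X\to\mathbb{R}$ ($j\in J:=\{1,\dots,p\}$) and $g_i\colon X\to\mathbb{R}$ ($i\in I:=\{1,\dots,m\}$) be continuously differentiable, and let $\mathcal{F}:=\{x\in X: g_i(x)\le 0,\ i\in I\}$. Consider the vector optimization problem (VP) of minimizing $f=(f_1,\dots,f_p)$ over $\mathcal{F}$ with respect to the componentwise order. Let $\bar x\in\mathcal{F}$ and let $f_j$, $j\in J$, and $g_i$, $i\in I(\bar x)$, be quasiconvex at $\bar x$. Suppose that $f_j$, $j\in J$, and $g_i$, $i\in I(\bar x)$, are second-order directionally differentiable at $\bar x$ in every critical direction $d\in\mathcal{C}(\bar x)$. If for each $d\in\mathcal{C}(\bar x)\setminus\{0\}$ there exist $\mu\in\mathbb{R}^p_+\setminus\{0\}$ and $\lambda\in\mathbb{R}^m_+$ such that $$\sum_{j=1}^p\mu_j\nabla f_j(\bar x)+\sum_{i=1}^m\lambda_i\nabla g_i(\bar x)=0,$$ $$\sum_{j=1}^p\mu_j f_j''(\bar x;d)+\sum_{i=1}^m\lambda_i g_i''(\bar x;d)>0,$$ $$\lambda_i g_i(\bar x)=0\quad\text{for all } i\in I,$$ then $\bar x$ is a strict global efficient solution of (VP).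
   Context: $\langle\cdot,\cdot\rangle$ is the Euclidean scalar product; $\mathbb{R}^p_+$ is the nonnegative orthant. Second-order directional derivative (Demyanov--Pevnyi): for $\phi\colon X\to\mathbb{R}$ differentiable at $x\in X$ and $d\in\mathbb{R}^n$, $$\phi''(x;d):=\lim_{t\downarrow0}\frac{2}{t^2}\big[\phi(x+td)-\phi(x)-t\langle\nabla\phi(x),d\rangle\big];$$ $\phi$ is second-order directionally differentiable at $x$ in the direction $d$ if this limit exists and is finite. $I(\bar x):=\{i\in I: g_i(\bar x)=0\}$. The set of critical directions at $\bar x$ is $\mathcal{C}(\bar x):=\{d\in\mathbb{R}^n:\langle\nabla f_j(\bar x),d\rangle\le0\ \forall j\in J,\ \langle\nabla g_i(\bar x),d\rangle\le0\ \forall i\in I(\bar x)\}$. Quasiconvexity: $\phi\colon X\to\mathbb{R}$ is quasiconvex at $\bar x$ if $y\in X$, $\phi(y)\le\phi(\bar x)$, $t\in[0,1]$, $(1-t)\bar x+ty\in X$ imply $\phi(\bar x+t(y-\bar x))\le\phi(\bar x)$. Strict global efficient solution: $\bar x\in\mathcal{F}$ such that there is no $x\in\mathcal{F}$ with $x\ne\bar x$ and $f_j(x)\le f_j(\bar x)$ for all $j\in J$. Convention: a term $\lambda_i g_i''(\bar x;d)$ with $\lambda_i=0$ (in particular with $i\notin I(\bar x)$) is taken to be $0$. *)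

(* Defs.v *)
From HB Require Import structures.
From mathcomp Require Import all_boot all_order all_algebra.
From mathcomp Require Import all_classical all_reals topology normedtype derive.

Set Implicit Arguments.
Unset Strict Implicit.
Unset Printing Implicit Defensive.
Import Order.TTheory GRing.Theory Num.Theory.
Import numFieldNormedType.Exports.

Local Open Scope classical_set_scope.
Local Open Scope ring_scope.

(** A function [phi : X -> R] on an open set [X] is represented by a total
    function ['rV[R]_n -> R] whose values outside [X] are irrelevant: the notions
    below either mention [X] explicitly or only depend on the germ of [phi] at a
    point of [X]. *)

Definition scalar_product (R : realType) (n : nat) (u v : 'rV[R]_n) : R :=
  \sum_(k < n) u 0 k * v 0 k.

(** Only used for functions that are differentiable (in the Frechet sense) at
    [x], where the partial derivatives do represent the differential. *)
Definition gradient (R : realType) (n : nat) (phi : 'rV[R]_n -> R)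
    (x : 'rV[R]_n) : 'rV[R]_n :=
  \row_(k < n) 'D_(delta_mx 0 k) phi x.

Definition continuously_differentiable_on (R : realType) (n : nat)
    (X : set 'rV[R]_n) (phi : 'rV[R]_n -> R) : Prop :=
  (forall x, X x -> differentiable phi x) /\
  {within X, continuous (gradient phi)}.

Definition second_order_quotient (R : realType) (n : nat)
    (phi : 'rV[R]_n -> R) (x d : 'rV[R]_n) (t : R) : R :=
  2 / t ^+ 2 *
    (phi (x + t *: d) - phi x - t * scalar_product (gradient phi x) d).

(** The limit is taken in [R], not in the extended reals, so that convergence
    means that the limit exists and is finite. *)
Definition second_order_dir_differentiable (R : realType) (n : nat)
    (phi : 'rV[R]_n -> R) (x d : 'rV[R]_n) : Prop :=
  cvg (second_order_quotient phi x d t @[t --> 0^'+]).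

(** An unspecified real number when the limit does not exist in [R]; hence
    [0 * second_order_dir_derivative phi x d] is [0] in all cases. *)
Definition second_order_dir_derivative (R : realType) (n : nat)
    (phi : 'rV[R]_n -> R) (x d : 'rV[R]_n) : R :=
  lim (second_order_quotient phi x d t @[t --> 0^'+]).

Definition quasiconvex_at (R : realType) (n : nat) (X : set 'rV[R]_n)
    (phi : 'rV[R]_n -> R) (x : 'rV[R]_n) : Prop :=
  forall (y : 'rV[R]_n) (t : R),
    X y -> phi y <= phi x -> 0 <= t <= 1 -> X ((1 - t) *: x + t *: y) ->
    phi (x + t *: (y - x)) <= phi x.

Definition feasible_set (R : realType) (n m : nat) (X : set 'rV[R]_n)
    (g : 'I_m -> 'rV[R]_n -> R) : set 'rV[R]_n :=
  [set x | X x /\ forall i, g i x <= 0].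

Definition active_set (R : realType) (n m : nat)
    (g : 'I_m -> 'rV[R]_n -> R) (x : 'rV[R]_n) : set 'I_m :=
  [set i | g i x = 0].

Definition critical_directions (R : realType) (n p m : nat)
    (f : 'I_p -> 'rV[R]_n -> R) (g : 'I_m -> 'rV[R]_n -> R)
    (x : 'rV[R]_n) : set 'rV[R]_n :=
  [set d | (forall j, scalar_product (gradient (f j) x) d <= 0) /\
           (forall i, active_set g x i ->
              scalar_product (gradient (g i) x) d <= 0)].

Definition nonneg_orthant (R : realType) (p : nat) : set 'rV[R]_p :=
  [set u | forall j, 0 <= u 0 j].

Definition strict_global_efficient (R : realType) (n p m : nat)
    (X : set 'rV[R]_n) (f : 'I_p -> 'rV[R]_n -> R)
    (g : 'I_m -> 'rV[R]_n -> R) (xbar : 'rV[R]_n) : Prop :=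
  feasible_set X g xbar /\
  ~ (exists x : 'rV[R]_n,
       [/\ feasible_set X g x, x <> xbar & forall j, f j x <= f j xbar]).

(* Main.v *)
(** Suppose [x <> xbar] is feasible and dominates [xbar], and put
    [d = x - xbar].  By quasiconvexity the objectives and the active constraints
    do not increase along [d] near [xbar], so [d] is critical.  In the stationarity
    equation paired with [d] all terms are nonpositive, hence zero: every function
    with a nonzero multiplier has zero slope along [d], and its second-order
    quotients are nonpositive.  This contradicts the second-order inequality. *)

Require Import Defs.
From HB Require Import structures.
From mathcomp Require Import all_boot all_order all_algebra.
From mathcomp Require Import all_classical all_reals topology normedtype derive.
Import Order.TTheory GRing.Theory Num.Theory.
Import numFieldNormedType.Exports.
Local Open Scope classical_set_scope.
Local Open Scope ring_scope.

Section SegmentBehaviour.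
Variables (R : realType) (n : nat).
Implicit Types (X : set 'rV[R]_n) (phi : 'rV[R]_n -> R) (x y d u v : 'rV[R]_n).

Lemma scalar_product_sumZl k (c : 'I_k -> R) (u : 'I_k -> 'rV[R]_n) v :
  scalar_product (\sum_(i < k) c i *: u i) v =
  \sum_(i < k) c i * scalar_product (u i) v.
Proof.
under [RHS]eq_bigr do rewrite /scalar_product mulr_sumr.
rewrite exchange_big; apply: eq_bigr => l _.
rewrite summxE mulr_suml; apply: eq_bigr => i _.
by rewrite mxE mulrA.
Qed.

Lemma scalar_productDl u u' v :
  scalar_product (u + u') v = scalar_product u v + scalar_product u' v.
Proof.
by rewrite /scalar_product -big_split; apply: eq_bigr => l _; rewrite mxE mulrDl.
Qed.

Lemma scalar_product0l v : scalar_product 0 v = 0 :> R.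
Proof. by rewrite /scalar_product big1// => l _; rewrite mxE mul0r. Qed.

(** Expand [d] in the standard basis: the differential is linear, and its values on the basis
    vectors are the entries of the gradient. *)
Lemma derive_gradient phi x d :
  differentiable phi x -> 'D_d phi x = scalar_product (gradient phi x) d.
Proof.
move=> dphi; rewrite deriveE// {1}(row_sum_delta d) linear_sum.
apply: eq_bigr => k _.
by rewrite linearZ mxE deriveE// mulrC.
Qed.

(** Quasiconvexity only speaks of points of the segment lying in [X], which need not be convex;
    openness puts [x + t *: (y - x)] in [X] for small [t]. *)
Lemma quasiconvex_near_le X phi x y : open X -> X x -> quasiconvex_at X phi x ->
  X y -> phi y <= phi x ->
  \forall t \near 0^'+, phi (x + t *: (y - x)) <= phi x.
Proof.
move=> oX Xx qphi Xy le_yx.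
have segE t : (1 - t) *: x + t *: y = x + t *: (y - x).
  by rewrite scalerBl scale1r scalerBr addrA addrAC.
have Xt : \forall t \near 0^'+, X (x + t *: (y - x)).
  have cvgx : x + t *: (y - x) @[t --> (0 : R)^'+] --> x.
    apply: cvg_at_right_filter.
    (* The limit [x] is written as the value of the path at [t = 0], so that the limit rules for
       sums and scalings apply. *)
    rewrite -[X in _ --> X]addr0 -(scale0r (y - x)).
    by apply: cvgD; [exact: cvg_cst|apply: cvgZr_tmp; exact: cvg_id].
  exact: (cvgx X (open_nbhs_nbhs (conj oX Xx))).
near=> t; apply: (qphi y t) => //.
  by apply/andP; split; apply: ltW; near: t;
    [exact: nbhs_right_gt|exact: nbhs_right_lt].
by rewrite segE; near: t.
Unshelve. all: by end_near. Qed.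

(** The slope is the right-hand limit of difference quotients that are eventually nonpositive. *)
Lemma near_le_gradient_le0 phi x d : differentiable phi x ->
  (\forall t \near 0^'+, phi (x + t *: d) <= phi x) ->
  scalar_product (gradient phi x) d <= 0.
Proof.
move=> dphi le_phi; rewrite -derive_gradient//.
have cvgD := cvg_dnbhs_at_right (diff_derivable (v := d) dphi).
apply: (cvgr_to_le cvgD).
near=> t.
have t0 : 0 < t by near: t; exact: nbhs_right_gt.
have : phi (x + t *: d) <= phi x by near: t.
by rewrite /= addrC -subr_le0 /GRing.scale/= pmulr_rle0// invr_gt0.
Unshelve. all: by end_near. Qed.

(** Once the first-order term vanishes, the second-order quotient is the nonpositive increment of
    [phi] times [2 / t ^+ 2], and the sign passes to the limit. *)
Lemma near_le_second_order_le0 phi x d :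
  second_order_dir_differentiable phi x d ->
  (\forall t \near 0^'+, phi (x + t *: d) <= phi x) ->
  scalar_product (gradient phi x) d = 0 ->
  second_order_dir_derivative phi x d <= 0.
Proof.
move=> cphi le_phi grad0; apply: limr_le => //.
near=> t.
have : phi (x + t *: d) <= phi x by near: t.
rewrite /second_order_quotient grad0 mulr0 subr0 -subr_le0.
by apply: mulr_ge0_le0; rewrite divr_ge0// sqr_ge0.
Unshelve. all: by end_near. Qed.

End SegmentBehaviour.

Theorem theorem3p4 (R : realType) (n p m : nat) (X : set 'rV[R]_n)
    (f : 'I_p -> 'rV[R]_n -> R) (g : 'I_m -> 'rV[R]_n -> R) (xbar : 'rV[R]_n)
    (X_nonempty : X !=set0) (X_open : open X)
    (f_C1 : forall j, continuously_differentiable_on X (f j))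
    (g_C1 : forall i, continuously_differentiable_on X (g i))
    (xbar_feasible : feasible_set X g xbar)
    (f_quasiconvex : forall j, quasiconvex_at X (f j) xbar)
    (g_quasiconvex : forall i, active_set g xbar i ->
       quasiconvex_at X (g i) xbar)
    (f_second_order : forall j d, critical_directions f g xbar d ->
       second_order_dir_differentiable (f j) xbar d)
    (g_second_order : forall i d, active_set g xbar i ->
       critical_directions f g xbar d ->
       second_order_dir_differentiable (g i) xbar d)
    (second_order_KKT : forall d, critical_directions f g xbar d -> d <> 0 ->
       exists (mu : 'rV[R]_p) (lambda : 'rV[R]_m),
         [/\ nonneg_orthant mu /\ mu <> 0,
             nonneg_orthant lambda,
             \sum_(j < p) mu 0 j *: gradient (f j) xbar +
               \sum_(i < m) lambda 0 i *: gradient (g i) xbar = 0,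
             0 < \sum_(j < p) mu 0 j * second_order_dir_derivative (f j) xbar d +
               \sum_(i < m) lambda 0 i * second_order_dir_derivative (g i) xbar d
           & forall i, lambda 0 i * g i xbar = 0]) :
  strict_global_efficient X f g xbar.
Proof.
have [Xx gx_le0] := xbar_feasible; split=> // -[x [[Xy gy_le0] x_neq le_f]].
set d := x - xbar.
have f_le j : \forall t \near 0^'+, f j (xbar + t *: d) <= f j xbar.
  exact: (@quasiconvex_near_le _ _ X).
have g_le i : active_set g xbar i ->
    \forall t \near 0^'+, g i (xbar + t *: d) <= g i xbar.
  (* At an active index [g i xbar] is 0, so feasibility of [x] already gives [g i x <= g i xbar]. *)
  by move=> gi0; apply: (@quasiconvex_near_le _ _ X); rewrite ?gi0//; exact: g_quasiconvex.
have gradf_le0 j : scalar_product (gradient (f j) xbar) d <= 0.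
  by apply: near_le_gradient_le0 => //; apply: (f_C1 j).1.
have gradg_le0 i : active_set g xbar i ->
    scalar_product (gradient (g i) xbar) d <= 0.
  by move=> gi0; apply: near_le_gradient_le0; [apply: (g_C1 i).1|exact: g_le].
have crit_d : critical_directions f g xbar d by split.
have d_neq0 : d <> 0 by move=> /subr0_eq.
have [mu [lam [[mu_ge0 _] lam_ge0 KKT sum_gt0 compl]]] :=
  second_order_KKT d crit_d d_neq0.
(* Complementarity confines nonzero multipliers to active constraints, the only ones whose behaviour
   along [d] is controlled. *)
have lam_active i : lam 0 i != 0 -> active_set g xbar i.
  by move=> lam_i; have /eqP := compl i; rewrite mulf_eq0 (negbTE lam_i) => /eqP.
have muf_le0 j : mu 0 j * scalar_product (gradient (f j) xbar) d <= 0.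
  exact: mulr_ge0_le0.
have lamg_le0 i : lam 0 i * scalar_product (gradient (g i) xbar) d <= 0.
  have [->|/lam_active gi0] := eqVneq (lam 0 i) 0; first by rewrite mul0r.
  by apply: mulr_ge0_le0; [exact: lam_ge0|exact: gradg_le0].
(* The signs are flipped so that a vanishing sum of nonnegative terms forces each term to vanish. *)
have /eqP : \sum_(j < p) - (mu 0 j * scalar_product (gradient (f j) xbar) d) +
            \sum_(i < m) - (lam 0 i * scalar_product (gradient (g i) xbar) d) = 0.
  rewrite !sumrN -opprD -!scalar_product_sumZl -scalar_productDl KKT.
  by rewrite scalar_product0l oppr0.
rewrite paddr_eq0 ?sumr_ge0// => [|i _|j _]; rewrite ?oppr_ge0//.
rewrite !psumr_eq0 => [|i _|j _]; rewrite ?oppr_ge0//.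
move=> /andP[/allP muf0 /allP lamg0].
move: sum_gt0; apply/negP; rewrite -leNgt -[leRHS]addr0.
apply: lerD; apply: sumr_le0.
  move=> j _; have [->|mu_j] := eqVneq (mu 0 j) 0; first by rewrite mul0r.
  apply: mulr_ge0_le0; first exact: mu_ge0.
  apply: near_le_second_order_le0 => //; first exact: f_second_order.
  have := muf0 j (mem_index_enum j).
  by rewrite /= oppr_eq0 mulf_eq0 (negbTE mu_j) => /eqP.
(* For an inactive [i] the second-order derivative may be an unspecified real; its multiplier is 0,
   so the product is 0 regardless. *)
move=> i _; have [->|lam_i] := eqVneq (lam 0 i) 0; first by rewrite mul0r.
have gi0 := lam_active i lam_i.
apply: mulr_ge0_le0; first exact: lam_ge0.
apply: near_le_second_order_le0; [exact: g_second_order|exact: g_le|].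
have := lamg0 i (mem_index_enum i).
by rewrite /= oppr_eq0 mulf_eq0 (negbTE lam_i) => /eqP.
Qed.
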